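(* Let $n \ge 1$ and let $(\mathcal{A},\mathcal{B})$ be a recovering pair on an $n$ element ground set. Then $$|\mathcal{A}||\mathcal{B}| \leq 2.284^n.$$
   Context: A pair $(\mathcal{A},\mathcal{B})$ of set systems (families of subsets) on an $n$ element ground set is called a recovering pair if for every $A,A' \in \mathcal{A}$ and $B,B' \in \mathcal{B}$: ($A \setminus B = A' \setminus B'$ implies $A=A'$) and ($B \setminus A = B' \setminus A'$ implies $B=B'$). *)

(* Defs.v *)
From mathcomp Require Import all_boot all_order all_algebra.

Set Implicit Arguments.
Unset Strict Implicit.
Unset Printing Implicit Defensive.

Definition recovering_pair (T : finType) (cA cB : {set {set T}}) : Prop :=
  forall A A' B B' : {set T},
    A \in cA -> A' \in cA -> B \in cB -> B' \in cB ->
    (A :\: B = A' :\: B' -> A = A') /\ (B :\: A = B' :\: A' -> B = B').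

(* Main.v *)
Require Import Defs.
From mathcomp Require Import all_boot all_order all_algebra.
From mathcomp Require Import ring lra reals Rstruct exp.

(** Let X and Y be independent and uniform on the two families, and measure
    entropy in bits. Since X \ Y determines X,
      H(X \ Y) = H(X) + E_x H(Y :&: x).
    The set function S |-> H(Y :&: S) is a polymatroid; let a be a vector of
    its base polytope, so that the a_i sum to log |B|, 0 <= a_i <= h(q_i) and
    H(Y :&: x) >= \sum_(i in x) a_i for all x. With p_i = P(i in X) and
    q_i = P(i in Y), subadditivity of H(X \ Y) gives
      log |A| + \sum_i p_i a_i <= \sum_i h(p_i (1 - q_i)),
    and symmetrically with a vector b for X. Adding c (log |A| + log |B|) to
    the sum of the two inequalities makes the bound a sum over coordinates of
      (c - p) a + (c - q) b + h(p (1 - q)) + h(q (1 - p)).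
    For c = 193/500 each summand is at most 33/20, and
    (33/20) / (1 + c) = 25/21 < log2 2.284. *)

Set Implicit Arguments.
Unset Strict Implicit.
Unset Printing Implicit Defensive.
Import Order.TTheory GRing.Theory Num.Theory.
Local Open Scope ring_scope.

(** * Binary entropy *)

Section BinaryEntropy.
Variable R : realType.
Implicit Types x y p q t : R.

Definition log2 x := ln x / ln 2.

Lemma ln2_gt0 : 0 < ln (2 : R).
Proof. by apply: ln_gt0; lra. Qed.

Lemma log2M x y : 0 < x -> 0 < y -> log2 (x * y) = log2 x + log2 y.
Proof. by move=> x0 y0; rewrite /log2 lnM ?posrE // mulrDl. Qed.

Lemma log2_div x y : 0 < x -> 0 < y -> log2 (x / y) = log2 x - log2 y.
Proof. by move=> x0 y0; rewrite /log2 ln_div ?posrE// mulrBl. Qed.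

Lemma log2X n x : 0 < x -> log2 (x ^+ n) = n%:R * log2 x.
Proof. by move=> x0; rewrite /log2 lnXn// -[ln x *+ n]mulr_natl mulrA. Qed.

Lemma log2_0 : log2 0 = 0.
Proof. by rewrite /log2 ln0 ?mul0r. Qed.

Lemma log2_1 : log2 1 = 0.
Proof. by rewrite /log2 ln1 mul0r. Qed.

Lemma log2_2 : log2 2 = 1.
Proof. by rewrite /log2 divff// gt_eqF// ln2_gt0. Qed.

Lemma ler_log2 x y : 0 < x -> 0 < y -> (log2 x <= log2 y) = (x <= y).
Proof. by move=> x0 y0; rewrite /log2 ler_pM2r ?invr_gt0 ?ln2_gt0// ler_ln ?posrE. Qed.

Lemma log2_le_sub1 x : 0 < x -> log2 x <= (x - 1) / ln 2.
Proof.
move=> x0; rewrite /log2 ler_pM2r ?invr_gt0 ?ln2_gt0//.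
by rewrite -[x in ln x](subrKC 1) le_ln1Dx//; lra.
Qed.

Definition hb p := - (p * log2 p + (1 - p) * log2 (1 - p)).

(** The bound $\ln x \le x - 1$ at $x = t/p$, multiplied by [p] so that it also covers [p = 0]. *)
Lemma mul_log2_le p t : 0 <= p -> 0 < t -> p * (log2 t - log2 p) <= (t - p) / ln 2.
Proof.
move=> p0 t0; have l2 := ln2_gt0; case: (eqVneq p 0) => [->|pN0].
  by rewrite mul0r subr0 divr_ge0// ltW.
have pp : 0 < p by rewrite lt_def pN0.
rewrite -log2_div//; apply: (@le_trans _ _ (p * ((t / p - 1) / ln 2))).
  by rewrite ler_wpM2l// log2_le_sub1// divr_gt0.
by rewrite mulrA mulrBr mulr1 mulrCA divff// mulr1.
Qed.

(** Gibbs' inequality for two Bernoulli laws: the error terms $t - p$ and $(1-t) - (1-p)$ cancel. *)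
Lemma hb_le p t : 0 <= p <= 1 -> 0 < t < 1 ->
  hb p <= p * - log2 t + (1 - p) * - log2 (1 - t).
Proof.
move=> /andP[p0 p1] /andP[t0 t1].
have := mul_log2_le p0 t0.
have : (1 - p) * (log2 (1 - t) - log2 (1 - p)) <= ((1 - t) - (1 - p)) / ln 2.
  by apply: mul_log2_le; lra.
rewrite /hb !mulrBl; lra.
Qed.

(** * Affine majorants of binary entropy *)

(* Holds as soon as 2^-x + 2^-y <= 1: the tangent to the concave function hb at any t in
   [2^-x, 1 - 2^-y] lies below this line. *)
Definition majorant x y := forall r : R, 0 <= r <= 1 -> hb r <= r * x + (1 - r) * y.

(** Turns a rational bound on a logarithm into an inequality between integer powers, which [lra] can
    decide. *)
Lemma oppr_log2_le t r s : 0 < t -> (0 < s)%N -> 1 <= t ^+ s * 2 ^+ r -> - log2 t <= r%:R / s%:R.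
Proof.
move=> t0 s0 h.
have : log2 1 <= log2 (t ^+ s * 2 ^+ r) by rewrite ler_log2// (lt_le_trans _ h).
rewrite log2_1 log2M ?exprn_gt0// !log2X// log2_2 ler_pdivlMr ?ltr0n//; lra.
Qed.

Lemma majorantP t r s r' s' : 0 < t < 1 -> (0 < s)%N -> (0 < s')%N ->
  1 <= t ^+ s * 2 ^+ r -> 1 <= (1 - t) ^+ s' * 2 ^+ r' ->
  majorant (r%:R / s%:R) (r'%:R / s'%:R).
Proof.
move=> t01 s0 s'0 h h' p p01; apply: le_trans (hb_le p01 t01) _.
case/andP: p01 t01 => p0 p1 /andP[t0 t1].
by rewrite lerD// ler_wpM2l// ?oppr_log2_le//; lra.
Qed.

Lemma majorant_sym x y : majorant x y -> majorant y x.
Proof.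
move=> m r r01; have /m : 0 <= 1 - r <= 1 by lra.
rewrite /hb; have -> : 1 - (1 - r) = r by lra.
lra.
Qed.

(* [maj_k_n] is the majorant obtained at t = k / n by rounding the two logarithms up. *)
Lemma maj_3_32 : majorant (41 / 12) (1 / 7).
Proof. by apply: (@majorantP (3 / 32) 41 12 1 7) => //; lra. Qed.

Lemma maj_2_17 : majorant (34 / 11) (2 / 11).
Proof. by apply: (@majorantP (2 / 17) 34 11 2 11) => //; lra. Qed.

Lemma maj_3_19 : majorant (8 / 3) (1 / 4).
Proof. by apply: (@majorantP (3 / 19) 8 3 1 4) => //; lra. Qed.

Lemma maj_3_16 : majorant (29 / 12) (3 / 10).
Proof. by apply: (@majorantP (3 / 16) 29 12 3 10) => //; lra. Qed.

Lemma maj_2_9 : majorant (24 / 11) (4 / 11).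
Proof. by apply: (@majorantP (2 / 9) 24 11 4 11) => //; lra. Qed.

Lemma maj_1_4 : majorant 2 (5 / 12).
Proof. by rewrite -[2]divr1; apply: (@majorantP (1 / 4) 2 1 5 12) => //; lra. Qed.

Lemma maj_7_24 : majorant (16 / 9) (1 / 2).
Proof. by apply: (@majorantP (7 / 24) 16 9 1 2) => //; lra. Qed.

Lemma maj_7_19 : majorant (13 / 9) (2 / 3).
Proof. by apply: (@majorantP (7 / 19) 13 9 2 3) => //; lra. Qed.

Lemma maj_7_18 : majorant (15 / 11) (5 / 7).
Proof. by apply: (@majorantP (7 / 18) 15 11 5 7) => //; lra. Qed.

Lemma maj_5_12 : majorant (14 / 11) (7 / 9).
Proof. by apply: (@majorantP (5 / 12) 14 11 7 9) => //; lra. Qed.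

Lemma maj_5_11 : majorant (8 / 7) (7 / 8).
Proof. by apply: (@majorantP (5 / 11) 8 7 7 8) => //; lra. Qed.

Lemma maj_7_15 : majorant (11 / 10) (10 / 11).
Proof. by apply: (@majorantP (7 / 15) 11 10 10 11) => //; lra. Qed.

Lemma maj_1_2 : majorant 1 1.
Proof.
rewrite -[X in majorant X]divr1 -[X in majorant _ X]divr1.
by apply: (@majorantP (1 / 2) 1 1 1 1) => //; lra.
Qed.

(** * The inequality for one coordinate *)

Definition gain p q a b :=
  (193 / 500 - p) * a + (193 / 500 - q) * b +
  hb (p * (1 - q)) + hb (q * (1 - p)).

(* [xu yu], [xv yv], [xq yq], [xp yp] are majorants used at p(1-q), q(1-p), q and p: the
   resulting bound on [gain] is affine in p and in q, so on a box it suffices to check the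
   corners. *)
Definition bilin xu yu xv yv xq yq xp yp p q :=
  p * (1 - q) * xu + (1 - p * (1 - q)) * yu +
  (q * (1 - p) * xv + (1 - q * (1 - p)) * yv) +
  (193 / 500 - p) * (q * xq + (1 - q) * yq) +
  (193 / 500 - q) * (p * xp + (1 - p) * yp).

(** The bounds on [a] and [b] include their coefficients, so that one statement serves for either
    sign of [193 / 500 - p] and [193 / 500 - q]. *)
Lemma gain_le_box p0 p1 q0 q1 xu yu xv yv xq yq xp yp p q a b :
  majorant xu yu -> majorant xv yv ->
  (193 / 500 - p) * a <= (193 / 500 - p) * (q * xq + (1 - q) * yq) ->
  (193 / 500 - q) * b <= (193 / 500 - q) * (p * xp + (1 - p) * yp) ->
  0 <= p <= 1 -> 0 <= q <= 1 ->
  p0 <= p <= p1 -> q0 <= q <= q1 -> p0 < p1 -> q0 < q1 ->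
  (forall p' q', p' \in [:: p0; p1] -> q' \in [:: q0; q1] ->
    bilin xu yu xv yv xq yq xp yp p' q' <= 33 / 20) ->
  gain p q a b <= 33 / 20.
Proof.
move=> mu mv ha h_b /andP[p0' p1'] /andP[q0' q1'] /andP[lp up] /andP[lq uq] p01 q01.
set F := bilin _ _ _ _ _ _ _ _ => corners.
have hu : hb (p * (1 - q)) <= p * (1 - q) * xu + (1 - p * (1 - q)) * yu.
  apply: mu; rewrite mulr_ge0 ?subr_ge0//= mulr_ile1 ?subr_ge0//; lra.
have hv : hb (q * (1 - p)) <= q * (1 - p) * xv + (1 - q * (1 - p)) * yv.
  apply: mv; rewrite mulr_ge0 ?subr_ge0//= mulr_ile1 ?subr_ge0//; lra.
have le_F : gain p q a b <= F p q by rewrite /gain /F /bilin; lra.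
apply: le_trans le_F _.
have area : 0 < (p1 - p0) * (q1 - q0) by rewrite mulr_gt0 ?subr_gt0.
rewrite -(ler_pM2l area).
(* Bilinear interpolation: scaled by the area of the box, [F p q] is a combination of the corner
   values with nonnegative weights. *)
have -> : (p1 - p0) * (q1 - q0) * F p q =
    (p1 - p) * (q1 - q) * F p0 q0 + (p1 - p) * (q - q0) * F p0 q1 +
    (p - p0) * (q1 - q) * F p1 q0 + (p - p0) * (q - q0) * F p1 q1.
  by rewrite /F /bilin; ring.
have -> : (p1 - p0) * (q1 - q0) * (33 / 20) =
    (p1 - p) * (q1 - q) * (33 / 20) + (p1 - p) * (q - q0) * (33 / 20) +
    (p - p0) * (q1 - q) * (33 / 20) + (p - p0) * (q - q0) * (33 / 20) by ring.
by rewrite !lerD// ler_wpM2l ?corners ?inE ?eqxx ?orbT// mulr_ge0// subr_ge0.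
Qed.

Lemma weight_le_majorant x y p q a : majorant x y -> 0 <= q <= 1 -> p <= 193 / 500 -> a <= hb q ->
  (193 / 500 - p) * a <= (193 / 500 - p) * (q * x + (1 - q) * y).
Proof.
by move=> m q01 pc aq; rewrite ler_wpM2l ?subr_ge0// (le_trans aq)// m.
Qed.

(* Here the coefficient of [a] is nonpositive, so the zero pair replaces a majorant. *)
Lemma neg_weight_le0 p q a : 193 / 500 <= p -> 0 <= a ->
  (193 / 500 - p) * a <= (193 / 500 - p) * (q * 0 + (1 - q) * 0).
Proof. by move=> pc a0; rewrite !mulr0 addr0 mulr0 mulr_le0_ge0// subr_le0. Qed.

(* One call settles one rectangle: linear side conditions, then four purely numerical corner
   checks. *)
Local Tactic Notation "box" uconstr(p0) uconstr(p1) uconstr(q0) uconstr(q1)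
    uconstr(mu) uconstr(mv) uconstr(ha) uconstr(hb) :=
  by refine (@gain_le_box p0 p1 q0 q1 _ _ _ _ _ _ _ _ _ _ _ _ mu mv ha hb _ _ _ _ _ _ _);
     [lra.. | clear => x y; rewrite !inE /bilin => /orP[]/eqP-> /orP[]/eqP->; lra].

(** Both coefficients are nonnegative, so [a] and [b] are replaced by majorants of [hb q] and
    [hb p]. *)
Lemma gain_le_near p q a b : 0 <= q -> q <= p -> p <= 193 / 500 ->
  a <= hb q -> b <= hb p -> gain p q a b <= 33 / 20.
Proof.
move=> q0 qp pc aq bp.
have p01 : 0 <= p <= 1 by lra.
have q01 : 0 <= q <= 1 by lra.
have qc : q <= 193 / 500 by lra.
have [?|?] := lerP p (3 / 10).
  have [?|?] := lerP q (3 / 10).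
    box 0 (3 / 10) 0 (3 / 10) maj_3_16 maj_3_16
      (weight_le_majorant maj_7_24 q01 pc aq) (weight_le_majorant maj_7_24 p01 qc bp).
  (* Excluded by [q <= p]. *)
  lra.
have [?|?] := lerP q (1 / 5).
  box (3 / 10) (193 / 500) 0 (1 / 5) maj_1_4 maj_2_17
    (weight_le_majorant maj_3_16 q01 pc aq) (weight_le_majorant maj_7_24 p01 qc bp).
have [?|?] := lerP q (3 / 10).
  box (3 / 10) (193 / 500) (1 / 5) (3 / 10) maj_1_4 maj_3_16
    (weight_le_majorant maj_1_4 q01 pc aq) (weight_le_majorant maj_7_19 p01 qc bp).
box (3 / 10) (193 / 500) (3 / 10) (193 / 500) maj_2_9 maj_2_9
  (weight_le_majorant maj_7_19 q01 pc aq) (weight_le_majorant maj_7_19 p01 qc bp).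
Qed.

(** The coefficient of [a] is nonpositive, so only [b] needs an entropy bound. *)
Lemma gain_le_mixed p q a b : 0 <= q -> q <= 193 / 500 -> 193 / 500 <= p -> p <= 1 ->
  0 <= a -> b <= hb p -> gain p q a b <= 33 / 20.
Proof.
move=> q0 qc pc p1 a0 bp.
have p01 : 0 <= p <= 1 by lra.
have q01 : 0 <= q <= 1 by lra.
have [?|?] := lerP p (9 / 20).
  have [?|?] := lerP q (1 / 4).
    box (193 / 500) (9 / 20) 0 (1 / 4) maj_7_24 maj_2_17
      (neg_weight_le0 q pc a0) (weight_le_majorant maj_5_12 p01 qc bp).
  box (193 / 500) (9 / 20) (1 / 4) (193 / 500) maj_7_24 maj_3_19
    (neg_weight_le0 q pc a0) (weight_le_majorant maj_5_11 p01 qc bp).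
have [?|?] := lerP p (3 / 5).
  have [?|?] := lerP q (1 / 5).
    box (9 / 20) (3 / 5) 0 (1 / 5) maj_7_18 maj_3_32
      (neg_weight_le0 q pc a0) (weight_le_majorant maj_7_15 p01 qc bp).
  have [?|?] := lerP q (1 / 4).
    box (9 / 20) (3 / 5) (1 / 5) (1 / 4) maj_7_19 maj_2_17
      (neg_weight_le0 q pc a0) (weight_le_majorant maj_1_2 p01 qc bp).
  box (9 / 20) (3 / 5) (1 / 4) (193 / 500) maj_7_19 maj_3_19
    (neg_weight_le0 q pc a0) (weight_le_majorant (majorant_sym maj_7_15) p01 qc bp).
box (3 / 5) 1 0 (193 / 500) maj_7_15 maj_3_32
  (neg_weight_le0 q pc a0) (weight_le_majorant (majorant_sym maj_7_18) p01 qc bp).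
Qed.

Lemma gain_le_far p q a b : 193 / 500 <= q -> q <= p -> p <= 1 ->
  0 <= a -> 0 <= b -> gain p q a b <= 33 / 20.
Proof.
move=> qc qp p1 a0 b0.
have pc : 193 / 500 <= p by lra.
have p01 : 0 <= p <= 1 by lra.
have q01 : 0 <= q <= 1 by lra.
have [?|?] := lerP p (1 / 2).
  have [?|?] := lerP q (1 / 2).
    box (193 / 500) (1 / 2) (193 / 500) (1 / 2) maj_1_4 maj_1_4
      (neg_weight_le0 q pc a0) (neg_weight_le0 p qc b0).
  lra.
have [?|?] := lerP p (3 / 5).
  have [?|?] := lerP q (3 / 5).
    box (1 / 2) (3 / 5) (193 / 500) (3 / 5) maj_7_24 maj_1_4
      (neg_weight_le0 q pc a0) (neg_weight_le0 p qc b0).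
  lra.
box (3 / 5) 1 (193 / 500) 1 maj_1_4 maj_3_19
  (neg_weight_le0 q pc a0) (neg_weight_le0 p qc b0).
Qed.

Lemma gain_le p q a b : 0 <= p <= 1 -> 0 <= q <= 1 ->
  0 <= a <= hb q -> 0 <= b <= hb p -> gain p q a b <= 33 / 20.
Proof.
wlog qp : p q a b / q <= p => [hw|].
  move=> p01 q01 a01 b01; have [|/ltW qp] := lerP q p; first by move/hw; apply.
  have -> : gain p q a b = gain q p b a by rewrite /gain; ring.
  exact: hw.
move=> /andP[p0 p1] /andP[q0 q1] /andP[a0 aq] /andP[b0 bp].
have [pc|/ltW pc] := lerP p (193 / 500); first exact: gain_le_near.
have [qc|/ltW qc] := lerP q (193 / 500); first exact: gain_le_mixed.
exact: gain_le_far.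
Qed.
End BinaryEntropy.

(** * Entropy of the traces of a random set *)

Section TraceEntropy.
Variables (R : realType) (W T : finType) (D : {set W}) (X : W -> {set T}).
Implicit Types (S : {set T}) (w u v : W).

Definition fiber S w := [set w' in D | X w' :&: S == X w :&: S].

(** Shannon entropy of [X w :&: S] for [w] uniform on [D]. It is averaged over [w] instead of over
    trace values: the trace of [w] has probability $|\mathrm{fiber}|/|D|$. *)
Definition ent S : R :=
  log2 #|D|%:R - (\sum_(w in D) log2 #|fiber S w|%:R) / #|D|%:R.

Lemma fiber_gt0 S w : w \in D -> 0 < #|fiber S w|%:R :> R.
Proof. by move=> wD; rewrite ltr0n; apply/card_gt0P; exists w; rewrite inE wD eqxx. Qed.

Lemma trace_sub S S' u v : S' \subset S ->
  X u :&: S = X v :&: S -> X u :&: S' = X v :&: S'.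
Proof. by move=> /setIidPr <- e; rewrite !setIA e. Qed.

Lemma fiber_sub S S' w : S' \subset S -> fiber S w \subset fiber S' w.
Proof.
move=> SS; apply/subsetP => u; rewrite !inE => /andP[-> /eqP e] /=.
by apply/eqP/(trace_sub SS e).
Qed.

Lemma trace_setU S S' u v :
  (X u :&: (S :|: S') == X v :&: (S :|: S')) =
  (X u :&: S == X v :&: S) && (X u :&: S' == X v :&: S').
Proof.
apply/eqP/andP => [e|[/eqP e /eqP e']]; last by rewrite !setIUr e e'.
by split; apply/eqP; apply: trace_sub e; rewrite ?subsetUl ?subsetUr.
Qed.

Lemma eq_fiber S u v : X u :&: S = X v :&: S -> fiber S u = fiber S v.
Proof. by move=> e; apply/setP => w; rewrite !inE e. Qed.

Lemma fiberE S w : #|fiber S w|%:R = \sum_(u in D) (X u :&: S == X w :&: S)%:R :> R.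
Proof.
rewrite -sum1_card natr_sum big_mkcond [RHS]big_mkcond /=; apply: eq_bigr => u _.
by rewrite inE; case: (u \in D) => //=; case: eqP.
Qed.

(** Only those [w] contribute that agree with [u] on [S] and with [v] on [S']. They form a single
    fiber of [S :|: S'], so its size cancels against their number; if there is one, [u] and [v]
    agree on [S :&: S']. *)
Lemma sum_fiber_pair S S' u v : u \in D -> v \in D ->
  \sum_(w in D) ((X u :&: S == X w :&: S)%:R * (X v :&: S' == X w :&: S')%:R)
     / (#|fiber (S :|: S') w|%:R * #|fiber (S :&: S') w|%:R)
  <= (X v :&: (S :&: S') == X u :&: (S :&: S'))%:R / #|fiber (S :&: S') u|%:R :> R.
Proof.
move=> uD vD.
set E := [set w in D | (X u :&: S == X w :&: S) && (X v :&: S' == X w :&: S')].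
have fU w : w \in E -> fiber (S :|: S') w = E.
  rewrite inE => /and3P[wD /eqP e /eqP e']; apply/setP => w'.
  by rewrite !inE trace_setU e e' (eq_sym (X w :&: S)) (eq_sym (X w :&: S')).
have fI w : w \in E -> fiber (S :&: S') w = fiber (S :&: S') u.
  rewrite inE => /and3P[_ /eqP e _].
  by apply/esym/eq_fiber/(trace_sub _ e)/subsetIl.
have -> : \sum_(w in D) ((X u :&: S == X w :&: S)%:R * (X v :&: S' == X w :&: S')%:R)
     / (#|fiber (S :|: S') w|%:R * #|fiber (S :&: S') w|%:R)
  = \sum_(w in E) (#|E|%:R * #|fiber (S :&: S') u|%:R)^-1 :> R.
  rewrite big_mkcond [RHS]big_mkcond /=; apply: eq_bigr => w _.
  have [wE|] := boolP (w \in E); last first.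
    by case: ifP => // wD; rewrite inE wD /=; do 2![case: eqP => _ //=]; rewrite ?(mul0r, mulr0).
  have := wE; rewrite (fU w wE) (fI w wE) inE => /and3P[-> -> ->].
  by rewrite !mul1r.
rewrite sumr_const; have [->|[w wE]] := set_0Vmem E.
  by rewrite cards0 mulr0n divr_ge0.
have /eqP -> : X v :&: (S :&: S') == X u :&: (S :&: S').
  move: (wE); rewrite inE => /and3P[_ /eqP e /eqP e']; apply/eqP.
  rewrite (trace_sub (subsetIl _ _) e).
  exact: (trace_sub (subsetIr S S') e').
rewrite eqxx mul1r -[_^-1 *+ _]mulr_natl invfM mulrA divff ?mul1r//.
by rewrite pnatr_eq0 -lt0n; apply/card_gt0P; exists w.
Qed.

(** Writing the numerators as sums over [u] and [v] and summing over [w] first, each [u] contributes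
    at most 1. *)
Lemma sum_fiber_ratio S S' :
  \sum_(w in D) (#|fiber S w|%:R * #|fiber S' w|%:R)
    / (#|fiber (S :|: S') w|%:R * #|fiber (S :&: S') w|%:R) <= #|D|%:R :> R.
Proof.
under eq_bigr => w _.
  rewrite [#|fiber S w|%:R]fiberE [#|fiber S' w|%:R]fiberE big_distrlr /= mulr_suml.
  under eq_bigr => u _ do rewrite mulr_suml.
  over.
rewrite exchange_big /=.
under eq_bigr => u _ do rewrite exchange_big /=.
apply: (@le_trans _ _ (\sum_(u in D) \sum_(v in D)
   (X v :&: (S :&: S') == X u :&: (S :&: S'))%:R / #|fiber (S :&: S') u|%:R)).
  by apply: ler_sum => u uD; apply: ler_sum => v vD; apply: sum_fiber_pair.
rewrite -sum1_card natr_sum; apply: ler_sum => u uD.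
by rewrite -mulr_suml -fiberE divff// gt_eqF// fiber_gt0.
Qed.

(** Nonnegativity of conditional mutual information: $\ln x \le x - 1$ is applied to the fiber
    ratio, whose mean is at most 1. *)
Lemma ent_submod S S' : ent (S :|: S') + ent (S :&: S') <= ent S + ent S'.
Proof.
suff le0 : \sum_(w in D) (log2 #|fiber S w|%:R + log2 #|fiber S' w|%:R
     - log2 #|fiber (S :|: S') w|%:R - log2 #|fiber (S :&: S') w|%:R) <= 0 :> R.
  have : (\sum_(w in D) (log2 #|fiber S w|%:R + log2 #|fiber S' w|%:R
     - log2 #|fiber (S :|: S') w|%:R - log2 #|fiber (S :&: S') w|%:R)) / #|D|%:R <= 0 :> R.
    by rewrite mulr_le0_ge0// invr_ge0.
  rewrite !sumrB big_split /= /ent !mulrBl mulrDl; lra.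
apply: (@le_trans _ _ (\sum_(w in D) ((#|fiber S w|%:R * #|fiber S' w|%:R)
    / (#|fiber (S :|: S') w|%:R * #|fiber (S :&: S') w|%:R) - 1) / ln 2)).
  apply: ler_sum => w wD; rewrite -log2M ?fiber_gt0//.
  rewrite -addrA -opprD -log2M ?fiber_gt0// -log2_div ?mulr_gt0 ?fiber_gt0//.
  by rewrite log2_le_sub1// divr_gt0 ?mulr_gt0 ?fiber_gt0.
rewrite -mulr_suml; apply: mulr_le0_ge0; last by rewrite invr_ge0 ltW ?ln2_gt0.
by rewrite sumrB sumr_const subr_le0 sum_fiber_ratio.
Qed.

Lemma ent0 : ent set0 = 0.
Proof.
rewrite /ent (eq_bigr (fun=> log2 #|D|%:R)) => [|w wD]; last first.
  by congr (log2 _%:R); apply: eq_card => u; rewrite !inE !setI0 eqxx andbT.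
rewrite sumr_const -[log2 _ *+ _]mulr_natl mulrAC.
have [->|D0] := eqVneq #|D| 0%N; first by rewrite !mul0r log2_0 subr0.
by rewrite divff ?pnatr_eq0// mul1r subrr.
Qed.

Lemma ent_mono S S' : S \subset S' -> ent S <= ent S'.
Proof.
move=> SS; rewrite lerB// ler_wpM2r ?invr_ge0//; apply: ler_sum => w wD.
by rewrite ler_log2 ?fiber_gt0// ler_nat subset_leq_card// fiber_sub.
Qed.

Lemma ent_setT : {in D &, injective X} -> ent setT = log2 #|D|%:R.
Proof.
move=> injX; rewrite /ent big1 ?mul0r ?subr0// => w wD.
rewrite (_ : fiber setT w = [set w]) ?cards1 ?log2_1//.
apply/setP => u; rewrite !inE !setIT; apply/andP/eqP => [[uD /eqP]|->//].
exact: injX.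
Qed.

(** The trace on a singleton has at most two fibers, [E] and its complement in [D]. *)
Lemma ent_set1 i : D != set0 ->
  ent [set i] = hb (#|[set w in D | i \in X w]|%:R / #|D|%:R).
Proof.
rewrite -card_gt0 => D0.
set E := [set w in D | i \in X w].
have fE w : fiber [set i] w = if i \in X w then E else D :\: E.
  apply/setP => u; rewrite !inE.
  have -> : (X u :&: [set i] == X w :&: [set i]) = ((i \in X u) == (i \in X w)).
    apply/eqP/eqP => [/setP/(_ i)|e]; first by rewrite !inE eqxx !andbT.
    by apply/setP => j; rewrite !inE; case: eqP => [->|]; rewrite ?andbT ?andbF.
  by case: (i \in X w); rewrite !inE; case: (u \in D); case: (i \in X u).
have ED : E \subset D by apply/subsetP => w; rewrite inE => /andP[].
have -> : ent [set i] = log2 #|D|%:R -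
    (#|E|%:R * log2 #|E|%:R + #|D :\: E|%:R * log2 #|D :\: E|%:R) / #|D|%:R.
  congr (_ - _ / _); rewrite (big_setID E) /= (setIidPr ED); congr (_ + _).
    rewrite (eq_bigr (fun=> log2 #|E|%:R)) ?sumr_const ?mulr_natl// => w.
    by rewrite inE fE => /andP[_ ->].
  rewrite (eq_bigr (fun=> log2 #|D :\: E|%:R)) ?sumr_const ?mulr_natl// => w.
  by rewrite !inE fE => /andP[+ wD]; rewrite wD /= => /negbTE->.
have DR : #|D|%:R != 0 :> R by rewrite pnatr_eq0 -lt0n.
have cD : #|D|%:R = #|E|%:R + #|D :\: E|%:R :> R.
  by rewrite -natrD -(cardsID E D) (setIidPr ED).
(* For [n = 0] the logarithm of the quotient does not split, but the factor in front vanishes. *)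
have pl (n : nat) : n%:R / #|D|%:R * log2 (n%:R / #|D|%:R) =
    n%:R / #|D|%:R * (log2 n%:R - log2 #|D|%:R) :> R.
  by case: n => [|n]; rewrite ?mul0r// log2_div ?ltr0n.
have -> : hb (#|E|%:R / #|D|%:R) =
  - (#|E|%:R / #|D|%:R * log2 (#|E|%:R / #|D|%:R) +
     #|D :\: E|%:R / #|D|%:R * log2 (#|D :\: E|%:R / #|D|%:R)) :> R.
  have -> : #|D :\: E|%:R / #|D|%:R = 1 - #|E|%:R / #|D|%:R :> R.
    by apply/(canRL (addrK _)); rewrite -mulrDl addrC -cD divff.
  by [].
rewrite !pl; move: (log2 _) (log2 _) (log2 _) cD DR => lD lE lF.
by move: (#|D|%:R : R) (#|E|%:R : R) (#|_ :\: _|%:R : R) => d e f -> DR; field.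
Qed.
End TraceEntropy.

(** * Base vectors of polymatroids *)

(* Edmonds' greedy vector: elements are added one at a time, each weighted by its marginal value. *)
Lemma polymatroid_base (R : realDomainType) (T : finType) (f : {set T} -> R) :
  f set0 = 0 -> (forall S S', f (S :|: S') + f (S :&: S') <= f S + f S') ->
  exists2 a : T -> R, \sum_i a i = f setT &
    forall S : {set T}, \sum_(i in S) a i <= f S.
Proof.
move=> f0 submod.
suff base (P : {set T}) : exists2 a : T -> R, \sum_(i in P) a i = f P &
    forall S : {set T}, S \subset P -> \sum_(i in S) a i <= f S.
  have [a aT aS] := base setT; exists a => [|S]; last exact/aS/subsetT.
  by rewrite -aT; apply: eq_bigl => i; rewrite inE.
have [n] := ubnP #|P|; elim: n => // n IHn in P *.
have [->|[i iP]] := set_0Vmem P => [_|].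
  exists (fun=> 0) => [|S]; rewrite ?big_set0 ?f0// subset0 => /eqP->.
  by rewrite big_set0 f0.
rewrite (cardsD1 i) iP ltnS => /IHn[a aP aS].
pose a' j := if j == i then f P - f (P :\ i) else a j.
have a'S (S : {set T}) : i \in S ->
    \sum_(j in S) a' j = f P - f (P :\ i) + \sum_(j in S :\ i) a j.
  move=> iS; rewrite (big_setD1 i iS) /= /a' eqxx; congr (_ + _).
  by apply: eq_bigr => j; rewrite !inE => /andP[/negbTE->].
exists a' => [|S SP]; first by rewrite a'S// aP subrK.
have [iS|iS] := boolP (i \in S); last first.
  rewrite (eq_bigr a) => [|j jS]; first by rewrite aS// subsetD1 SP.
  by rewrite /a'; case: eqP jS iS => // -> ->.
have SPi : S :\ i \subset P :\ i by apply: setSD.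
(* Diminishing returns: the marginal value of [i] over [P :\ i] is at most that over [S :\ i]. *)
have := submod S (P :\ i).
have -> : S :|: (P :\ i) = P.
  apply/setP => j; rewrite !inE; case: eqP => [->|_] /=; first by rewrite iS iP.
  by case: (boolP (j \in S)) => //= /(subsetP SP)->.
have -> : S :&: (P :\ i) = S :\ i.
  by rewrite setIDA (setIidPl SP).
by rewrite a'S//; have := aS _ SPi; lra.
Qed.

(** * Marginal frequencies and base vectors of the trace entropy *)

Section Marginals.
Variables (R : realType) (W T : finType) (D : {set W}) (X : W -> {set T}).

Definition freq i : R := #|[set w in D | i \in X w]|%:R / #|D|%:R.

Lemma freq_itv i : 0 <= freq i <= 1.
Proof.
rewrite /freq divr_ge0//=; have [->|D0] := eqVneq #|D| 0%N; first by rewrite invr0 mulr0.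
rewrite ler_pdivrMr ?ltr0n ?lt0n// mul1r ler_nat subset_leq_card//.
by apply/subsetP => w; rewrite inE => /andP[].
Qed.

Lemma ent_base : D != set0 ->
  exists a : T -> R, [/\ \sum_i a i = ent R D X setT,
    forall S : {set T}, \sum_(i in S) a i <= ent R D X S &
    forall i, 0 <= a i <= hb (freq i)].
Proof.
move=> D0; have [a aT aS] := polymatroid_base (ent0 R D X) (ent_submod R D X).
exists a; split=> // i; apply/andP; split; last first.
  by rewrite /freq -ent_set1// (le_trans _ (aS _))// big_set1.
(* Nonnegativity of [a i]: the other weights sum to at most the entropy of the complement of [i],
   hence to at most the total. *)
have := le_trans (aS (~: [set i])) (ent_mono R D X (subsetT _)).
rewrite -aT [leRHS](bigD1 i)//= (eq_bigl (fun j => j != i)) => [|j]; last by rewrite !inE.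
by rewrite lerDr.
Qed.

Lemma ent_le_sum_hb : D != set0 -> ent R D X setT <= \sum_i hb (freq i).
Proof.
move=> /ent_base[a [<- _ a_le]]; apply: ler_sum => i _.
by have /andP[] := a_le i.
Qed.
End Marginals.

Lemma recovering_pairC (T : finType) (cA cB : {set {set T}}) :
  recovering_pair cA cB -> recovering_pair cB cA.
Proof. by move=> rec B B' A A' ? ? ? ?; have [] := rec A A' B B'. Qed.

(** * Recovering pairs *)

Section RecoveringPair.
Variables (R : realType) (T : finType) (cA cB : {set {set T}}).
Hypotheses (rec : recovering_pair cA cB) (A0 : cA != set0) (B0 : cB != set0).

Let diff (w : {set T} * {set T}) := w.1 :\: w.2.
Let pA := freq R cA id.
Let pB := freq R cB id.

Lemma freq_diff i : freq R (setX cA cB) diff i = pA i * (1 - pB i).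
Proof.
have -> : 1 - pB i = #|[set B in cB | i \notin B]|%:R / #|cB|%:R.
  have b0 : #|cB|%:R != 0 :> R by rewrite pnatr_eq0 -lt0n card_gt0.
  apply/esym/(canRL (addrK _)); rewrite /pB /freq -mulrDl -natrD.
  have <- : #|cB| = (#|[set B in cB | i \notin B]| + #|[set B in cB | i \in B]|)%N.
    rewrite -(cardsID [set B : {set T} | i \in B] cB) addnC; congr (_ + _)%N.
      by apply: eq_card => B; rewrite !inE andbC.
    by apply: eq_card => B; rewrite !inE.
  by rewrite divff.
rewrite /freq mulrACA -invfM -!natrM -!cardsX; congr (_%:R / _).
by apply: eq_card => -[A B]; rewrite !inE /= /diff ?inE /=; do !case: (_ \in _).
Qed.

(** The recovering property enters here: equal differences have the same [A], and for fixed [A] the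
    difference carries the same information as [B :&: A]. *)
Lemma card_fiber_diff A B : A \in cA -> B \in cB ->
  #|fiber (setX cA cB) diff setT (A, B)| = #|fiber cB id A B|.
Proof.
move=> AA BB.
have -> : fiber (setX cA cB) diff setT (A, B) = setX [set A] (fiber cB id A B).
  apply/setP => -[A' B']; rewrite !inE !setIT /= /diff /=.
  have eqD (C C' : {set T}) : (A :\: C == A :\: C') = (C :&: A == C' :&: A).
    apply/eqP/eqP => /setP e; apply/setP => i; have := e i; rewrite !inE.
      by case: (i \in A) => //; rewrite ?andbF ?andbT// => /negb_inj.
    by case: (i \in A) => //; rewrite ?andbF ?andbT// => ->.
  apply/andP/and3P => [[/andP[A'A B'B] /eqP e]|[/eqP-> B'B e]].
    have [/(_ e) eA _] := rec A'A AA B'B BB.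
    by rewrite -eqD -e eA eqxx.
  by rewrite AA B'B eqD.
by rewrite cardsX cards1 mul1n.
Qed.

(** The chain rule, read off from the fiber sizes. *)
Lemma ent_diff : ent R (setX cA cB) diff setT =
  log2 #|cA|%:R + (\sum_(A in cA) ent R cB id A) / #|cA|%:R.
Proof.
have a0 : #|cA|%:R != 0 :> R by rewrite pnatr_eq0 -lt0n card_gt0.
have b0 : #|cB|%:R != 0 :> R by rewrite pnatr_eq0 -lt0n card_gt0.
rewrite /ent cardsX natrM log2M ?ltr0n ?card_gt0//.
have -> : \sum_(w in setX cA cB) log2 #|fiber (setX cA cB) diff setT w|%:R =
    \sum_(A in cA) \sum_(B in cB) log2 #|fiber cB id A B|%:R :> R.
  rewrite pair_big_dep /=; apply: eq_big => -[A B]; rewrite !inE//= => /andP[? ?].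
  by rewrite card_fiber_diff.
rewrite sumrB sumr_const -mulr_suml -mulr_natl.
by move: (log2 _) (log2 _) (\sum_(_ in _) _) => lA lB s; field; rewrite a0 b0.
Qed.

Lemma recovering_entropy_le (a : T -> R) :
  (forall S : {set T}, \sum_(i in S) a i <= ent R cB id S) ->
  log2 #|cA|%:R + \sum_i pA i * a i <= \sum_i hb (pA i * (1 - pB i)).
Proof.
move=> aS; have AB0 : setX cA cB != set0.
  by rewrite -card_gt0 cardsX muln_gt0 !card_gt0 A0 B0.
under [leRHS]eq_bigr => i _ do rewrite -freq_diff.
apply: le_trans (ent_le_sum_hb R diff AB0); rewrite ent_diff lerD2l.
(* Double counting: the mean weight of a random [A] in [cA]. *)
have -> : \sum_i pA i * a i = (\sum_(A in cA) \sum_(i in A) a i) / #|cA|%:R.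
  under [in RHS]eq_bigr => A _ do rewrite big_mkcond.
  rewrite exchange_big /= mulr_suml; apply: eq_bigr => i _.
  rewrite /pA /freq mulrAC; congr (_ / _).
  rewrite -big_mkcondr /= sumr_const mulr_natl; congr (_ *+ _).
  by apply: eq_card => A; rewrite !inE.
by rewrite ler_wpM2r ?invr_ge0//; apply: ler_sum.
Qed.
End RecoveringPair.

Lemma recovering_log2_le (R : realType) (T : finType) (cA cB : {set {set T}}) :
  recovering_pair cA cB -> cA != set0 -> cB != set0 ->
  log2 (#|cA| * #|cB|)%:R <= #|T|%:R * (25 / 21) :> R.
Proof.
move=> rec A0 B0.
have [b [sum_b b_ent b_le]] := ent_base R id A0.
have [a [sum_a a_ent a_le]] := ent_base R id B0.
have := recovering_entropy_le rec A0 B0 a_ent.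
have := recovering_entropy_le (recovering_pairC rec) B0 A0 b_ent.
rewrite natrM log2M ?ltr0n ?card_gt0//.
rewrite !ent_setT in sum_a sum_b; try by move=> ? ? _ _.
rewrite -sum_a -sum_b.
set p := freq R cA id; set q := freq R cB id => leB leA.
have : \sum_i gain (p i) (q i) (a i) (b i) <= #|T|%:R * (33 / 20).
  rewrite mulr_natl -sumr_const.
  by apply: ler_sum => i _; apply: gain_le; rewrite ?freq_itv.
rewrite /gain !big_split /=.
have -> : \sum_i (193 / 500 - p i) * a i = 193 / 500 * \sum_i a i - \sum_i p i * a i.
  by rewrite mulr_sumr -sumrB; apply: eq_bigr => i _; rewrite mulrBl.
have -> : \sum_i (193 / 500 - q i) * b i = 193 / 500 * \sum_i b i - \sum_i q i * b i.
  by rewrite mulr_sumr -sumrB; apply: eq_bigr => i _; rewrite mulrBl.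
(* The coefficient [1 + 193 / 500] is [693 / 500], and [33 / 20] divided by it is [25 / 21]. *)
lra.
Qed.

Theorem mainTheorem1 (n : nat) (T : finType) (cA cB : {set {set T}})
    (hn : (1 <= n)%N) (hT : #|T| = n) (hrec : recovering_pair cA cB) :
  ((#|cA| * #|cB|)%N%:R <= 2.284%Q ^+ n :> rat)%R.
Proof.
have [->|A0] := eqVneq cA set0; first by rewrite cards0 mul0n exprn_ge0.
have [->|B0] := eqVneq cB set0; first by rewrite cards0 muln0 exprn_ge0.
(* Logarithms require a real field, so the rational inequality is transported to one. *)
pose R : realType := Rdefinitions.R.
rewrite -(ler_rat R) rmorphXn /= ratr_nat.
have -> : ratr 2.284%Q = 571 / 250 :> R.
  have -> : 2.284%Q = 571 / 250 by apply/eqP.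
  by rewrite fmorph_div /= !ratr_nat.
rewrite -ler_log2 ?ltr0n ?muln_gt0 ?card_gt0 ?A0 ?exprn_gt0//; last by lra.
apply: le_trans (recovering_log2_le R hrec A0 B0) _.
rewrite hT log2X; last by lra.
rewrite ler_wpM2l// ler_pdivrMr//.
(* Integer-power form of $25/21 \le \log_2 2.284$. *)
have : log2 (2 ^+ 25) <= log2 ((571 / 250) ^+ 21) :> R by rewrite ler_log2; lra.
rewrite !log2X; [|lra..]; rewrite log2_2; lra.
Qed.
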